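(* Let $S=k[x_1,\ldots,x_n]$ be a polynomial ring over a field $k$ and let $I\subset S$ be a squarefree monomial ideal generated in degree $d$. If the first syzygy graph $G_I$ is a tree, then the following are equivalent: (a) $I$ has a linear resolution; (b) $I$ is a variable-decomposable ideal; (c) $I$ has linear quotients.
   Context: $G(I)=\{u_1,\ldots,u_m\}$ denotes the minimal monomial generating set; $F(u)=\{i : x_i\mid u\}$; $\varphi:\bigoplus_{i} S e_i\to I$, $e_i\mapsto u_i$. First syzygy graph $G_I$: start with the graph on vertex set $G(I)$ in which distinct $u_i,u_j$ are adjacent iff there are variables $x,y$ with $xu_i=yu_j$; such an edge gives the linear relation $xe_i-ye_j\in\ker(\varphi)$. A triangle is of type (i) if its vertices have supports $A\cup\{j,k\}$, $A\cup\{i,k\}$, $A\cup\{i,j\}$ for some set $A$ and distinct $i,j,k\notin A$; then one of the three corresponding relations is a combination of the other two. $G_I$ is obtained by deleting redundant edges of triangles of type (i) (one edge from each such triangle) so that no such triangle remains and the relations of the remaining edges form a minimal generating set of the degree $d+1$ part of $\ker(\varphi)$; any fixed choice of such deletions is allowed. $I$ has a linear resolution if its minimal graded free resolution is $0\to S(-d-p)^{\beta_p}\to\cdots\to S(-d-1)^{\beta_1}\to S(-d)^{\beta_0}\to I\to 0$. $I$ has linear quotients if $G(I)$ can be ordered $v_1,\ldots,v_m$ so that each colon ideal $\langle v_1,\ldots,v_{i-1}\rangle : v_i$, $2\le i\le m$, is generated by a subset of the variables. Variable-decomposable (for squarefree monomial ideals), recursively: $|G(I)|=1$, or there is a variable $x_l$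 such that, with $I_{x_l}$ generated by the elements of $G(I)$ not divisible by $x_l$ and $I^{x_l}$ generated by those divisible by $x_l$: $I_{x_l}\ne 0$; for each $u\in G(I_{x_l})$ there is $v\in G(I^{x_l})$ with $v/\gcd(u,v)=x_l$; and both $I_{x_l}$ and $I^{x_l}$ are variable-decomposable. *)

(* Defs.v *)
From HB Require Import structures.
From mathcomp Require Import all_boot all_order all_algebra.
From mathcomp Require Export mpoly.

Set Implicit Arguments.
Unset Strict Implicit.
Unset Printing Implicit Defensive.

Import GRing.Theory.
Local Open Scope ring_scope.

(* Monomials of S = k[x_0, ..., x_(n-1)] are handled through their exponent
   vectors 'X_{1..n}; divisibility is (_ <= _)%MM. Ideals of {mpoly k[n]} are
   Prop-valued predicates (the idealr structure of MathComp excludes I = S,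
   which is allowed here, with d = 0). *)

Section Ideals.
Variables (k : fieldType) (n : nat).

Definition ideal_gen (P : {mpoly k[n]} -> Prop) (f : {mpoly k[n]}) : Prop :=
  exists2 s : seq ({mpoly k[n]} * {mpoly k[n]}),
    forall c, c \in s -> P c.2 & f = \sum_(c <- s) c.1 * c.2.

Definition monomial_ideal (P : 'X_{1..n} -> Prop) : {mpoly k[n]} -> Prop :=
  ideal_gen (fun f => exists2 u, P u & f = 'X_[u]).

Definition variable_ideal (B : {set 'I_n}) : {mpoly k[n]} -> Prop :=
  ideal_gen (fun f => exists2 i, i \in B & f = 'X_i).

Definition colon (J : {mpoly k[n]} -> Prop) (g f : {mpoly k[n]}) : Prop :=
  J (f * g).

Definition squarefree (u : 'X_{1..n}) : Prop := forall i, (u i <= 1)%N.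

Definition squarefree_monomial_ideal (I : {mpoly k[n]} -> Prop) : Prop :=
  exists2 P : 'X_{1..n} -> Prop,
    forall u, P u -> squarefree u & forall f, I f <-> monomial_ideal P f.

(* G(I): the monomials of I that are minimal for divisibility. *)
Definition min_gen (I : {mpoly k[n]} -> Prop) (u : 'X_{1..n}) : Prop :=
  I 'X_[u] /\ forall v : 'X_{1..n}, I 'X_[v] -> (v <= u)%MM -> v = u.

Definition generated_in_degree (I : {mpoly k[n]} -> Prop) (d : nat) : Prop :=
  forall u, min_gen I u -> mdeg u = d.

Definition enumerates_min_gens (I : {mpoly k[n]} -> Prop)
    (s : seq 'X_{1..n}) : Prop :=
  uniq s /\ forall u, u \in s <-> min_gen I u.

Definition linear_quotients (I : {mpoly k[n]} -> Prop) : Prop :=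
  exists2 v : seq 'X_{1..n}, enumerates_min_gens I v &
    forall i, (0 < i < size v)%N ->
      exists B : {set 'I_n}, forall f,
        colon (monomial_ideal (fun u => u \in take i v)) 'X_[nth 0%MM v i] f
        <-> variable_ideal B f.

(* The ideals written I_{x_l} and I^{x_l} in the literature. *)
Definition nondiv_part (I : {mpoly k[n]} -> Prop) (l : 'I_n) :
    {mpoly k[n]} -> Prop :=
  monomial_ideal (fun u => min_gen I u /\ ~~ (U_(l) <= u)%MM).

Definition div_part (I : {mpoly k[n]} -> Prop) (l : 'I_n) :
    {mpoly k[n]} -> Prop :=
  monomial_ideal (fun u => min_gen I u /\ (U_(l) <= u)%MM).

Definition mgcd (u v : 'X_{1..n}) : 'X_{1..n} :=
  [multinom minn (u i) (v i) | i < n].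

Inductive variable_decomposable (I : {mpoly k[n]} -> Prop) : Prop :=
| VDecOne of (exists u, forall v, min_gen I v <-> v = u)
| VDecStep (l : 'I_n) of
    (exists2 f, nondiv_part I l f & f != 0) &
    (forall u, min_gen (nondiv_part I l) u ->
       exists2 v, min_gen (div_part I l) v & (v - mgcd u v)%MM = U_(l)%MM) &
    variable_decomposable (nondiv_part I l) &
    variable_decomposable (div_part I l).

(* F_p is the direct sum of the S(-shift p j), j < rank p, with elements
   written as row vectors; matrices act on the right. An entry of a
   degree-preserving map from S(-a) to S(-b) is homogeneous of degree a - b,
   hence zero if a < b. *)
Definition homog_entry (a b : nat) (f : {mpoly k[n]}) : Prop :=
  if (b <= a)%N then is_true (f \is (a - b).-homog) else f = 0.

Record min_graded_free_resolution (I : {mpoly k[n]} -> Prop) := MinGFRes {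
  rank : nat -> nat;
  shift : forall p, 'I_(rank p) -> nat;
  augm : 'cV[{mpoly k[n]}]_(rank 0);
  diff : forall p, 'M[{mpoly k[n]}]_(rank p.+1, rank p);
  finite_length : exists N, forall p, (N < p)%N -> rank p = 0%N;
  augm_homog : forall j, homog_entry (shift j) 0 (augm j 0);
  diff_homog : forall p i j, homog_entry (shift i) (shift j) (diff p i j);
  augm_onto : forall f, I f <-> exists w : 'rV_(rank 0), f = (w *m augm) 0 0;
  exact0 : forall w : 'rV_(rank 0),
    w *m augm = 0 <-> exists z : 'rV_(rank 1), w = z *m diff 0;
  exactS : forall p (w : 'rV_(rank p.+1)),
    w *m diff p = 0 <-> exists z : 'rV_(rank p.+2), w = z *m diff p.+1;
  (* the image of each differential lies in (x_0, ..., x_(n-1)) F_p *)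
  minimality : forall p i j, (diff p i j)@_0%MM = 0
}.

Definition linear_resolution (I : {mpoly k[n]} -> Prop) (d : nat) : Prop :=
  exists R : min_graded_free_resolution I,
    forall p (j : 'I_(rank R p)), shift j = (d + p)%N.

End Ideals.

Section SyzygyGraph.
Variables (k : fieldType) (n m : nat) (u : m.-tuple 'X_{1..n}).

(* Graphs on the vertices u_0, ..., u_(m-1) are relations on 'I_m. *)

Definition linear_edge (i j : 'I_m) : bool :=
  (i != j) &&
  [exists x : 'I_n, exists y : 'I_n,
     (U_(x) + tnth u i)%MM == (U_(y) + tnth u j)%MM].

Definition msupport (v : 'X_{1..n}) : {set 'I_n} := [set i | v i != 0%N].

Definition type_i (a b c : 'I_m) : Prop :=
  exists (A : {set 'I_n}) (i j l : 'I_n),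
    [/\ uniq [:: i; j; l], [/\ i \notin A, j \notin A & l \notin A],
        msupport (tnth u a) = A :|: [set j; l],
        msupport (tnth u b) = A :|: [set i; l] &
        msupport (tnth u c) = A :|: [set i; j]].

Definition type_i_triangle (E : rel 'I_m) (a b c : 'I_m) : Prop :=
  [/\ E a b, E b c, E a c & type_i a b c].

Definition delete_edge (E : rel 'I_m) (a b : 'I_m) : rel 'I_m :=
  fun x y => [&& E x y, (x, y) != (a, b) & (x, y) != (b, a)].

(* Deleting edges one at a time, each from a triangle of type (i) still present
   in the current graph. *)
Inductive reduction : rel 'I_m -> Prop :=
| RedStart E of E =2 linear_edge : reduction E
| RedDelete E E' a b c of
    reduction E & type_i_triangle E a b c & E' =2 delete_edge E a b :
    reduction E'.

(* The map phi sending e_i to u_i. *)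
Definition phi (w : 'rV[{mpoly k[n]}]_m) : {mpoly k[n]} :=
  \sum_(i < m) w 0 i * 'X_[tnth u i].

(* The degree d+1 part of ker phi, e_i having degree d: the coordinates are
   linear forms. *)
Definition linear_syzygy (w : 'rV[{mpoly k[n]}]_m) : Prop :=
  (forall i, w 0 i \is 1.-homog) /\ phi w = 0.

(* One relation per edge: the orientation i < j is chosen, the other one giving
   the opposite vector. *)
Definition edge_relation (E : rel 'I_m) (w : 'rV[{mpoly k[n]}]_m) : Prop :=
  exists (i j : 'I_m) (x y : 'I_n),
    [/\ (i < j)%N, E i j, (U_(x) + tnth u i)%MM = (U_(y) + tnth u j)%MM &
        w = 'X_x *: delta_mx 0 i - 'X_y *: delta_mx 0 j].

Definition kspan (P : 'rV[{mpoly k[n]}]_m -> Prop)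
    (w : 'rV[{mpoly k[n]}]_m) : Prop :=
  exists2 s : seq (k * 'rV[{mpoly k[n]}]_m),
    forall c, c \in s -> P c.2 & w = \sum_(c <- s) c.1%:MP *: c.2.

Definition minimal_generating_set (V P : 'rV[{mpoly k[n]}]_m -> Prop) : Prop :=
  (forall w, kspan P w <-> V w) /\
  forall Q : 'rV[{mpoly k[n]}]_m -> Prop,
    (forall w, Q w -> P w) -> (forall w, kspan Q w <-> V w) ->
    forall w, P w -> Q w.

Definition first_syzygy_graph (E : rel 'I_m) : Prop :=
  [/\ reduction E,
      forall a b c, ~ type_i_triangle E a b c &
      minimal_generating_set linear_syzygy (edge_relation E)].

Definition is_tree (E : rel 'I_m) : Prop :=
  [/\ (0 < m)%N, ssrbool.symmetric E, irreflexive E,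
      forall a b, connect E a b &
      forall c : seq 'I_m, ucycle E c -> (size c <= 2)%N].

End SyzygyGraph.

(* Main.v *)
Require Import Defs.
From mathcomp Require Import all_boot all_order all_algebra.
From mathcomp Require Import zify.
From Stdlib Require Import Classical_Prop.

Set Implicit Arguments.
Unset Strict Implicit.
Unset Printing Implicit Defensive.

Import GRing.Theory.
Local Open Scope ring_scope.

(** Why the equivalence holds. An edge of a graph on the generators [u_i] stands
    for the relation [X^(L - u_i) e_i - X^(L - u_j) e_j], [L = lcm (u_i, u_j)];
    when the edge is linear both coefficients are variables. Write [edge_span]
    for the submodule of the free module spanned by the relations of the edges
    of [G_I]. By the choice of [G_I] it contains all linear syzygies, so a linear
    resolution forces every syzygy of the [u_i] into it
    ([linear_resolution_kernel]), and so do linear quotients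
    ([quotients_kernel]).

    From a linear resolution to a decomposition: the relation of two arbitrary
    generators [u_a], [u_b] lies in [edge_span], and comparing coefficients of
    the monomial [lcm (u_a, u_b)] shows that [a] and [b] are joined by a path
    through generators dividing this lcm ([edge_span_connect]). If [a] is a leaf
    with neighbour [b], every such path from [a] passes through [b], so the
    variable [x] with [u_b / gcd (u_a, u_b) = x] divides every generator except
    [u_a]. Shedding [x] separates [u_a] from the others, for which the path
    property persists, and one concludes by induction ([tree_decomposable]).

    A decomposition at [x] gives linear quotients by listing the generators
    divisible by [x] before the others ([variable_decomposable_quotients]).

    From linear quotients back to a linear resolution: the relations of the edges
    generate all syzygies, and in a tree they are linearly independent, since at
    a leaf only one of them has a nonzero coordinate ([edge_mx_free]). Hence the
    edges of the tree give a resolution of length one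
    ([tree_linear_resolution]). *)

(** * Monomial ideals *)

Section MonomialIdeals.
Variables (k : fieldType) (n : nat).
Implicit Types (f g : {mpoly k[n]}) (t u v : 'X_{1..n}).
Implicit Types (P : 'X_{1..n} -> Prop) (J : {mpoly k[n]} -> Prop).

Lemma lem_anti u v : (u <= v)%MM -> (v <= u)%MM -> u = v.
Proof.
move=> /mnm_lepP uv /mnm_lepP vu; apply/mnmP=> i.
by apply/eqP; rewrite eqn_leq uv vu.
Qed.

Lemma lem_mdeg_eq u v : (u <= v)%MM -> (mdeg v <= mdeg u)%N -> u = v.
Proof.
move=> le_uv; rewrite -(submK le_uv) mdegD.
rewrite -[X in (_ <= X)%N -> _]add0n leq_add2r leqn0 mdeg_eq0 => /eqP ->.
by rewrite add0m.
Qed.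

Lemma mcoeff_mulX g u t :
  (g * 'X_[u])@_t = if (u <= t)%MM then g@_(t - u)%MM else 0.
Proof.
case: ifP => [le_ut | not_le]; first by rewrite -{1}(submK le_ut) addmC mcoeffMX.
apply: memN_msupp_eq0; apply/negP.
rewrite (perm_mem (msuppMX g u)) => /mapP[r _ def_t].
by move: not_le; rewrite def_t lem_addr.
Qed.

(** Membership is decided monomial by monomial, which reduces every question
    about these ideals to divisibility of exponent vectors. *)
Lemma monomial_idealP P f :
  monomial_ideal P f <->
  forall t, t \in msupp f -> exists2 u, P u & (u <= t)%MM.
Proof.
split=> [[s sP ->] t | supp_f].
  move/msupp_sum_le/flatten_mapP => [c]; rewrite mem_filter => /andP[_ c_s].
  have [u Pu ->] := sP c c_s.
  rewrite (perm_mem (msuppMX c.1 u)) => /mapP[r _ ->].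
  by exists u => //; apply: lem_addr.
have: forall r : seq 'X_{1..n}, {subset r <= msupp f} ->
  exists2 s : seq ({mpoly k[n]} * {mpoly k[n]}),
    forall c, c \in s -> exists2 u, P u & c.2 = 'X_[u] &
    \sum_(t <- r) f@_t *: 'X_[t] = \sum_(c <- s) c.1 * c.2.
  elim=> [|t r IHr] sub_r; first by exists [::] => //; rewrite !big_nil.
  have [|s sP eq_s] := IHr; first by move=> v v_r; rewrite sub_r // inE v_r orbT.
  have [u Pu le_ut] : exists2 u, P u & (u <= t)%MM.
    by apply: supp_f; rewrite sub_r ?mem_head.
  exists ((f@_t *: 'X_[t - u], 'X_[u]) :: s).
    by move=> c; rewrite inE => /predU1P[-> | /sP //]; exists u.
  by rewrite !big_cons eq_s /= -scalerAl -mpolyXD submK.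
case/(_ (msupp f)) => // s sP eq_s.
by exists s => //; rewrite {1}[f]mpolyE eq_s.
Qed.

Lemma monomial_ideal_X P t :
  monomial_ideal (k := k) P 'X_[t] <-> exists2 u, P u & (u <= t)%MM.
Proof.
split=> [/monomial_idealP | [u Pu le_ut]].
  by apply; rewrite msuppX mem_head.
by apply/monomial_idealP=> v; rewrite msuppX inE => /eqP ->; exists u.
Qed.

Lemma variable_idealP (B : {set 'I_n}) f :
  variable_ideal B f <->
  forall t, t \in msupp f -> exists2 i, i \in B & (U_(i) <= t)%MM.
Proof.
have -> : variable_ideal B f <->
    monomial_ideal (fun u => exists2 i, i \in B & u = U_(i)%MM) f.
  split=> -[s sP ->]; exists s => // c /sP.
    by case=> i iB ->; exists U_(i)%MM => //; exists i.
  by case=> _ [i iB ->] ->; exists i.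
split=> [/monomial_idealP fP t /fP[_ [i iB ->] le_it] | fP]; first by exists i.
apply/monomial_idealP=> t /fP[i iB le_it].
by exists U_(i)%MM => //; exists i.
Qed.

(** Both ideals are monomial, so they agree as soon as they contain the same
    monomials. *)
Lemma colon_variableP P v (B : {set 'I_n}) :
  (forall f, colon (monomial_ideal P) 'X_[v] f <-> variable_ideal B f) <->
  (forall t, (exists2 u, P u & (u <= t + v)%MM) <->
             (exists2 i, i \in B & (U_(i) <= t)%MM)).
Proof.
split=> [colonB t | monoB f].
  have := colonB 'X_[t]; rewrite /colon -mpolyXD.
  rewrite monomial_ideal_X => ->; split=> [/variable_idealP | [i iB le_it]].
    by apply; rewrite msuppX mem_head.
  by apply/variable_idealP => r; rewrite msuppX inE => /eqP ->; exists i.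
rewrite /colon; split=> [/monomial_idealP fP | /variable_idealP fB].
  apply/variable_idealP=> t t_f; apply/monoB/fP.
  by rewrite (perm_mem (msuppMX f v)); apply/mapP; exists t; rewrite // addmC.
apply/monomial_idealP=> t; rewrite (perm_mem (msuppMX f v)).
by case/mapP=> r r_f ->; rewrite addmC; apply/monoB/fB.
Qed.

(** Minimal generators never divide each other properly, so any subset of them
    minimally generates the ideal that it spans. This identifies the minimal
    generators of [div_part] and [nondiv_part]. *)
Lemma min_gen_anti J u v : min_gen J u -> min_gen J v -> (u <= v)%MM -> u = v.
Proof. by move=> [Ju _] [_ minv] le_uv; apply: minv. Qed.

Lemma min_gen_monomial_ideal P :
    (forall u v, P u -> P v -> (u <= v)%MM -> u = v) ->
  forall u, min_gen (monomial_ideal (k := k) P) u <-> P u.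
Proof.
move=> antiP u; split=> [[/monomial_ideal_X[v Pv le_vu] minu] | Pu].
  by rewrite -(minu v) //; apply/monomial_ideal_X; exists v; rewrite ?lepm_refl.
split; first by apply/monomial_ideal_X; exists u; rewrite ?lepm_refl.
move=> v /monomial_ideal_X[w Pw le_wv] le_vu.
have eq_wu : w = u by apply: antiP => //; apply: lepm_trans le_vu.
by apply: lem_anti => //; rewrite -eq_wu.
Qed.

Lemma min_gen_div_part J (l : 'I_n) u :
  min_gen (div_part J l) u <-> min_gen J u /\ (U_(l) <= u)%MM.
Proof.
by apply: min_gen_monomial_ideal => {}u v [Ju _] [Jv _]; apply: min_gen_anti Jv.
Qed.

Lemma min_gen_nondiv_part J (l : 'I_n) u :
  min_gen (nondiv_part J l) u <-> min_gen J u /\ ~~ (U_(l) <= u)%MM.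
Proof.
by apply: min_gen_monomial_ideal => {}u v [Ju _] [Jv _]; apply: min_gen_anti Jv.
Qed.

Lemma min_gen_below J t : J 'X_[t] -> exists2 u, min_gen J u & (u <= t)%MM.
Proof.
have [m] := ubnP (mdeg t); elim: m => // m IHm in t * => lt_tm Jt.
have [[v [Jv le_vt ne_vt]] | no_smaller] :=
    classic (exists v, [/\ J 'X_[v], (v <= t)%MM & v <> t]); last first.
  exists t; last exact: lepm_refl.
  split=> // v Jv le_vt; apply: NNPP => ne_vt.
  by apply: no_smaller; exists v.
have lt_vt : (mdeg v < mdeg t)%N.
  by rewrite ltnNge; apply/negP => /(lem_mdeg_eq le_vt).
have [|//|u min_u le_uv] := IHm v; first exact: leq_trans lt_vt lt_tm.
by exists u => //; apply: lepm_trans le_vt.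
Qed.

Lemma squarefree_idealP J : squarefree_monomial_ideal J ->
  (forall f, J f <-> monomial_ideal (min_gen J) f) /\
  forall u, min_gen J u -> squarefree u.
Proof.
case=> P sqP defJ.
have JX t : J 'X_[t] <-> exists2 u, P u & (u <= t)%MM.
  by rewrite defJ monomial_ideal_X.
split=> [f | u [Ju minu]].
  rewrite defJ; split=> /monomial_idealP fP; apply/monomial_idealP=> t /fP[u].
    move=> Pu le_ut; have Jt : J 'X_[t] by apply/JX; exists u.
    by have [v] := min_gen_below Jt; exists v.
  case=> /JX[v Pv le_vu] _ le_ut.
  by exists v => //; apply: lepm_trans le_ut.
have /JX[v Pv le_vu] := Ju.
rewrite -(minu v) //; first exact: sqP.
by apply/JX; exists v; rewrite ?lepm_refl.
Qed.

End MonomialIdeals.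

(** * Linear quotients from a decomposition *)

Section LinearQuotients.
Variables (k : fieldType) (n : nat).
Implicit Types (u v t : 'X_{1..n}) (s : seq 'X_{1..n}).
Implicit Types (J : {mpoly k[n]} -> Prop).

(** The combinatorial form of linear quotients. The index [i = 0] is allowed: it
    is satisfied by the empty set of variables, and including it spares the
    later inductions a special case. *)
Definition quotient_order s : Prop :=
  forall i, (i < size s)%N -> exists B : {set 'I_n}, forall t,
    (exists2 u, u \in take i s & (u <= t + nth 0%MM s i)%MM) <->
    (exists2 l, l \in B & (U_(l) <= t)%MM).

Lemma linear_quotientsP J : linear_quotients J <->
  exists2 s, enumerates_min_gens J s & quotient_order s.
Proof.
split=> -[s enum_s quo_s]; exists s => // i.
  move=> lt_is; case: (posnP i) => [-> | i_gt0].
    by exists set0 => t; rewrite take0; split=> -[u]; rewrite ?inE.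
  have [|B colonB] := quo_s i; first by rewrite i_gt0.
  by exists B; apply/colon_variableP.
case/andP=> _ lt_is; have [B monoB] := quo_s i lt_is.
by exists B; apply/colon_variableP.
Qed.

(** List the generators divisible by [x_l] first. For a later generator [u], the
    exchange condition puts [x_l] in the colon ideal, and every [v] divisible by
    [x_l] contributes a multiple of [x_l]; so the colon ideal is the one inside
    the nondivisible part with [x_l] added. *)
Lemma variable_decomposable_quotients J :
  variable_decomposable J -> linear_quotients J.
Proof.
move=> decJ; apply/linear_quotientsP; elim: decJ => {J} [J [u genJ] | J l].
  exists [:: u]; first by split=> // v; rewrite inE genJ; split=> /eqP.
  by case=> // _; exists set0 => t; split=> -[v]; rewrite ?inE.
move=> _ exch _ [s2 [uniq2 enum2] quo2] _ [s1 [uniq1 enum1] quo1].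
have s1P u : u \in s1 <-> min_gen J u /\ (U_(l) <= u)%MM.
  by rewrite enum1 min_gen_div_part.
have s2P u : u \in s2 <-> min_gen J u /\ ~~ (U_(l) <= u)%MM.
  by rewrite enum2 min_gen_nondiv_part.
exists (s1 ++ s2).
  split=> [|u].
    rewrite cat_uniq uniq1 uniq2 andbT /=; apply/hasPn=> u /s2P[_ not_lu].
    by apply/negP => /s1P[_ lu]; rewrite lu in not_lu.
  rewrite mem_cat; split=> [/orP[/s1P[] | /s2P[]] // | min_u].
  case: (boolP (U_(l) <= u)%MM) => lu; apply/orP; first by left; apply/s1P.
  by right; apply/s2P.
move=> i; rewrite size_cat nth_cat take_cat => lt_i.
case: ltnP => [/quo1 // | le_i]; set j := (i - size s1)%N.
have lt_j : (j < size s2)%N by rewrite /j ltn_subLR.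
set u := nth _ _ _.
have u_s2 : u \in s2 by apply: mem_nth.
have [min_u not_lu] := (s2P u).1 u_s2.
have [B quoB] := quo2 j lt_j.
exists (l |: B) => t; split=> [[v] | [b]]; last first.
  rewrite in_setU1 => /predU1P[-> lt | bB le_bt].
    have [v /enum1 v_s1 def_l] := exch u ((enum2 u).1 u_s2).
    exists v; first by rewrite mem_cat v_s1.
    apply/mnm_lepP => i'; rewrite mnmDE.
    move/mnmP/(_ i'): def_l; rewrite mnmBE mnmE => def_l.
    by move/mnm_lepP/(_ i'): lt; rewrite -def_l; lia.
  have [|v v_s2 le_v] := (quoB t).2; first by exists b.
  by exists v; rewrite // mem_cat v_s2 orbT.
rewrite mem_cat => /orP[/s1P[_ lv] le_v | v_s2 le_v].
  exists l; first by rewrite !inE eqxx.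
  move: lv not_lu; rewrite !lep1mP => lv; rewrite negbK => /eqP u0.
  by move/mnm_lepP/(_ l): le_v; rewrite mnmDE; lia.
have [|b bB le_bt] := (quoB t).1; first by exists v.
by exists b => //; rewrite !inE bB orbT.
Qed.

End LinearQuotients.

(** * Leaves of acyclic graphs *)

Section Leaves.
Variables (T : finType) (e : rel T).
Hypotheses (e_sym : ssrbool.symmetric e) (e_irr : irreflexive e).
Hypothesis (e_acyc : forall c, ucycle e c -> (size c <= 2)%N).

(** A chord from the start of a simple path to any later vertex than the first
    would close a cycle of length at least three. *)
Lemma acyclic_path_nbr x p y :
  path e x p -> uniq (x :: p) -> e x y -> y \in p -> y = head x p.
Proof.
move=> pth uniq_p exy y_p; case/splitPr: y_p pth uniq_p => p1 p2.
rewrite -cat_rcons cat_path -cat_cons cat_uniq => /andP[pth1 _] /andP[uniq1 _].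
have := e_acyc (c := x :: rcons p1 y).
rewrite /ucycle uniq1 /= rcons_path pth1 last_rcons e_sym exy size_rcons.
by move/(_ isT); case: (p1).
Qed.

(** The end of a longest path cannot have two neighbours: one of them would
    either extend the path or close a cycle of length at least three. *)
Lemma acyclic_leaf (W : {set T}) : W != set0 ->
  exists2 a, a \in W &
    forall b c, b \in W -> c \in W -> e a b -> e a c -> b = c.
Proof.
case/set0Pn=> x0 x0W.
have [/existsP[a /andP[aW /forall_inP leaf_a]] | no_leaf] := boolP
    [exists a in W, [forall b in W, [forall c in W, e a b && e a c ==> (b == c)]]].
  exists a => // b c bW cW eab eac; apply/eqP.
  by have /forall_inP/(_ c cW)/implyP := leaf_a b bW; rewrite eab eac; apply.
(* If every vertex had two neighbours in W, simple paths could be prolonged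
   forever. *)
have longer j : exists x p,
    [/\ path e x p, uniq (x :: p), all (mem W) (x :: p) & size p = j].
  elim: j => [|j [x [p [pth uniq_p /= /andP[xW pW] sz_p]]]].
    by exists x0, [::]; rewrite /= x0W.
  have [y [yW exy y_p]] : exists y, [/\ y \in W, e x y & y \notin p].
    move/existsPn/(_ x): no_leaf; rewrite xW /=.
    case/forall_inPn=> b bW /forall_inPn[c cW].
    rewrite negb_imply => /andP[/andP[exb exc] ne_bc].
    case: (boolP (b \in p)) => [b_p | ]; last by exists b.
    exists c; split=> //; apply/negP=> c_p; case/eqP: ne_bc.
    have -> := acyclic_path_nbr pth uniq_p exb b_p.
    by have -> := acyclic_path_nbr pth uniq_p exc c_p.
  exists y, (x :: p); split; last by rewrite /= sz_p.
  - by rewrite /= e_sym exy.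
  - rewrite /= inE negb_or y_p andbT; move: uniq_p => /= ->; rewrite andbT.
    by apply: contraTneq exy => ->; rewrite e_irr.
  by rewrite /= yW xW.
have [x [p [_ uniq_p _ sz_p]]] := longer #|T|.
have := max_card (mem (x :: p)).
by rewrite (card_uniqP uniq_p) [size _]/= sz_p ltnn.
Qed.

End Leaves.

(** * Relations carried by edges *)

Section EdgeRelations.
Variables (k : fieldType) (n m : nat) (u : m.-tuple 'X_{1..n}) (E : rel 'I_m).
Local Notation S := {mpoly k[n]}.

Definition gens : 'cV[S]_m := \col_i 'X_[tnth u i].

Lemma phiE (w : 'rV[S]_m) : phi u w = (w *m gens) 0 0.
Proof. by rewrite /phi mxE; apply: eq_bigr => i _; rewrite mxE. Qed.

Lemma phi_eq0 (w : 'rV[S]_m) : phi u w = 0 <-> w *m gens = 0.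
Proof.
rewrite phiE; split=> [w0 | ->]; last by rewrite mxE.
by apply/rowP=> i; rewrite ord1 w0 mxE.
Qed.

(** The relation between two monomials in the Taylor complex. For a linear edge
    its coefficients are the two variables of the edge relation, and it has the
    advantage of depending on no choice of these variables. *)
Definition taylor (i j : 'I_m) : 'rV[S]_m :=
  'X_[mlcm (tnth u i) (tnth u j) - tnth u i] *: delta_mx 0 i
  - 'X_[mlcm (tnth u i) (tnth u j) - tnth u j] *: delta_mx 0 j.

(** Restricting the map [e_o |-> u_o] to the [e_o] selected by [h]; the full map
    gives the syzygy property, a component of a graph the connectivity of
    [edge_span_connect]. *)
Lemma taylor_mul_col (h : 'I_m -> bool) i j (L := mlcm (tnth u i) (tnth u j)) :
  (taylor i j *m \col_o ('X_[tnth u o] *+ h o)) 0 0 = 'X_[L] *+ h i - 'X_[L] *+ h j.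
Proof.
rewrite /taylor mulmxBl -!scalemxAl -!rowE !mxE !mulrnAr -!mpolyXD.
by rewrite !submK ?lem_mlcml ?lem_mlcmr.
Qed.

Lemma taylor_gens i j : taylor i j *m gens = 0.
Proof.
have -> : gens = \col_o ('X_[tnth u o] *+ true) by apply/colP=> o; rewrite !mxE.
by apply/rowP=> o; rewrite ord1 (taylor_mul_col xpredT) subrr mxE.
Qed.

Lemma mlcm_linear (v w : 'X_{1..n}) (x y : 'I_n) : v <> w ->
    (U_(x) + v)%MM = (U_(y) + w)%MM ->
  (mlcm v w - v)%MM = U_(x)%MM /\ (mlcm v w - w)%MM = U_(y)%MM.
Proof.
move=> ne_vw eq_vw.
have ne_xy : x <> y.
  by move=> eq_xy; apply: ne_vw; move: eq_vw; rewrite eq_xy => /addmI.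
have not_both i : (x == i) && (y == i) = false.
  by apply/negP=> /andP[/eqP eq_xi /eqP eq_yi]; apply: ne_xy; rewrite eq_xi.
by split; apply/mnmP=> i; have := (mnmP _ _).1 eq_vw i; have := not_both i;
  rewrite !mnmE; case: (x == i); case: (y == i) => //=; lia.
Qed.

(** One orientation per edge, so that the rows of [edge_mx] can be independent. *)
Definition edges : {set 'I_m * 'I_m} :=
  [set e : 'I_m * 'I_m | (e.1 < e.2)%N && E e.1 e.2].

Definition edge_mx : 'M[S]_(#|edges|, m) :=
  \matrix_(e < #|edges|) taylor (enum_val e).1 (enum_val e).2.

Lemma edge_mxE e i : edge_mx e i = taylor (enum_val e).1 (enum_val e).2 0 i.
Proof. by rewrite mxE. Qed.

Lemma taylorE (i j o : 'I_m) (L := mlcm (tnth u i) (tnth u j)) : taylor i j 0 o =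
  'X_[L - tnth u i] *+ (o == i) - 'X_[L - tnth u j] *+ (o == j).
Proof. by rewrite !mxE !mulr_natr. Qed.

Lemma edge_mx_gens : edge_mx *m gens = 0.
Proof.
by apply/row_matrixP=> e; rewrite row_mul rowK taylor_gens row0.
Qed.

Definition edge_span (w : 'rV[S]_m) : Prop := exists z, w = z *m edge_mx.

Lemma edge_spanD v w : edge_span v -> edge_span w -> edge_span (v + w).
Proof. by move=> [y ->] [z ->]; exists (y + z); rewrite mulmxDl. Qed.

Lemma edge_spanZ c w : edge_span w -> edge_span (c *: w).
Proof. by move=> [z ->]; exists (c *: z); rewrite scalemxAl. Qed.

Lemma edge_span0 : edge_span 0.
Proof. by exists 0; rewrite mul0mx. Qed.

Lemma edge_span_sum (I : eqType) (r : seq I) (F : I -> 'rV[S]_m) :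
  (forall i, i \in r -> edge_span (F i)) -> edge_span (\sum_(i <- r) F i).
Proof.
move=> Fspan; rewrite big_seq; elim/big_rec: _ => [|i w /Fspan].
  exact: edge_span0.
exact: edge_spanD.
Qed.

Lemma edge_span_mulmx p (z : 'rV[S]_p) (A : 'M[S]_(p, m)) :
  (forall i, edge_span (row i A)) -> edge_span (z *m A).
Proof.
move=> Aspan; rewrite mulmx_sum_row; apply: edge_span_sum => i _.
exact: edge_spanZ.
Qed.

Hypothesis u_uniq : uniq u.

Lemma tnth_uniq_inj : injective (tnth u).
Proof. by apply/tuple_uniqP. Qed.

Lemma edge_relation_span w : edge_relation u E w -> edge_span w.
Proof.
case=> i [j] [x] [y] [lt_ij Eij eq_ij ->].
have ne_ij : tnth u i <> tnth u j.
  by move/tnth_uniq_inj=> eq_ij'; rewrite eq_ij' ltnn in lt_ij.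
have [defx defy] := mlcm_linear ne_ij eq_ij.
have e_in : (i, j) \in edges by rewrite inE /= lt_ij.
exists (delta_mx 0 (enum_rank_in e_in (i, j))).
by rewrite -rowE rowK (enum_rankK_in e_in e_in) /taylor /= defx defy.
Qed.

Lemma linear_syzygy_span w :
  minimal_generating_set (linear_syzygy u) (edge_relation (k := k) u E) ->
  linear_syzygy u w -> edge_span w.
Proof.
case=> spanE _ /spanE[s sE ->]; apply: edge_span_sum => c /sE c_rel.
exact/edge_spanZ/edge_relation_span.
Qed.

Lemma reduction_linear_edge (F : rel 'I_m) :
  reduction u F -> subrel F (linear_edge u).
Proof.
elim=> {F} [F eqF | F F' a b c _ subF _ eqF] i j; rewrite eqF //.
by case/and3P=> /subF.
Qed.

Hypothesis E_linear : subrel E (linear_edge u).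

Lemma taylor_linear i j : E i j -> exists x y,
  [/\ (U_(x) + tnth u i)%MM = (U_(y) + tnth u j)%MM &
      taylor i j = 'X_x *: delta_mx 0 i - 'X_y *: delta_mx 0 j].
Proof.
move/E_linear; case/andP=> /eqP ne_ij /existsP[x /existsP[y /eqP eq_ij]].
have ne_u : tnth u i <> tnth u j by move/tnth_uniq_inj.
have [defx defy] := mlcm_linear ne_u eq_ij.
by exists x, y; split; first exact: eq_ij; rewrite /taylor defx defy.
Qed.

Lemma edge_mx_homog e i : edge_mx e i \is 1.-homog.
Proof.
have: enum_val e \in edges by apply: enum_valP.
rewrite inE => /andP[_ /taylor_linear[x [y [_ def_e]]]].
rewrite edge_mxE def_e !mxE !mulr_natr.
by apply: rpredB; apply: rpredMn; rewrite dhomogX /= mdeg1.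
Qed.

Hypothesis E_sym : ssrbool.symmetric E.
Hypothesis E_irr : irreflexive E.
Hypothesis E_acyc : forall c, ucycle E c -> (size c <= 2)%N.

(** In a relation between the rows, the edges with nonzero coefficient form an
    acyclic graph; at a leaf of it only one row has a nonzero entry. *)
Lemma edge_mx_free (z : 'rV[S]_#|edges|) : z *m edge_mx = 0 -> z = 0.
Proof.
move=> z_rel; apply/eqP/negPn/negP => nz_z.
pose F : rel 'I_m := fun i j => [exists e, (z 0 e != 0) &&
  ((enum_val e == (i, j)) || (enum_val e == (j, i)))].
have FP i j : reflect (exists2 e, z 0 e != 0 &
    (enum_val e == (i, j)) || (enum_val e == (j, i))) (F i j).
  apply: (iffP existsP) => [[e /andP[]] | [e ze eij]]; exists e => //.
  by rewrite ze eij.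
have F_sym : ssrbool.symmetric F.
  by move=> i j; apply: eq_existsb => e; rewrite orbC.
have sFE : subrel F E.
  move=> i j /FP[e _]; have := enum_valP e; rewrite inE => /andP[_ Ee].
  by case/orP=> /eqP def_e; move: Ee; rewrite def_e //= E_sym.
have F_irr : irreflexive F.
  by move=> i; apply: contraFF (E_irr i); apply: sFE.
have F_acyc c : ucycle F c -> (size c <= 2)%N.
  move=> /andP[cyc uniq_c]; apply: E_acyc; rewrite /ucycle uniq_c andbT.
  by move: cyc; apply: sub_cycle.
have [e0 ze0] : exists e, z 0 e != 0.
  apply/existsP; apply: contraR nz_z => /existsPn z0.
  by apply/eqP/rowP=> e; have := z0 e; rewrite negbK mxE => /eqP.
have [|a] := acyclic_leaf F_sym F_irr F_acyc (W := [set i | [exists j, F i j]]).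
  apply/set0Pn; exists (enum_val e0).1; rewrite inE; apply/existsP.
  exists (enum_val e0).2; apply/FP; exists e0 => //.
  by rewrite -surjective_pairing eqxx.
rewrite inE => /existsP[b Fab] leaf_a.
have inW i j : F i j -> j \in [set i | [exists j, F i j]].
  by rewrite inE F_sym => Fij; apply/existsP; exists i.
have [e ze eab] := FP _ _ Fab.
(* Any other edge of F meeting the leaf a would lead to the same b. *)
have only_e e' : z 0 e' != 0 -> edge_mx e' a != 0 -> e' = e.
  move=> ze' nz; apply: enum_val_inj.
  have lt_e (f : 'I_#|edges|) : ((enum_val f).1 < (enum_val f).2)%N.
    by have := enum_valP f; rewrite inE => /andP[].
  have [c Fac e'ac] : exists2 c, F a c &
      (enum_val e' == (a, c)) || (enum_val e' == (c, a)).
    case: (altP ((enum_val e').1 =P a)) => [eq1 | ne1].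
      exists (enum_val e').2; last by rewrite -eq1 -surjective_pairing eqxx.
      by apply/FP; exists e'; rewrite // -eq1 -surjective_pairing eqxx.
    case: (altP ((enum_val e').2 =P a)) => [eq2 | ne2].
      have e'E : enum_val e' == ((enum_val e').1, a).
        by rewrite -eq2 -surjective_pairing.
      exists (enum_val e').1; rewrite ?e'E ?orbT //.
      by apply/FP; exists e'; rewrite ?e'E ?orbT.
    case/eqP: nz; rewrite edge_mxE taylorE ![a == _]eq_sym (negbTE ne1) (negbTE ne2).
    by rewrite !mulr0n subr0.
  have eq_cb := leaf_a _ _ (inW _ _ Fac) (inW _ _ Fab) Fac Fab.
  have := lt_e e'; have := lt_e e; move: e'ac eab; rewrite eq_cb.
  case/orP=> /eqP ->; case/orP=> /eqP -> //= lt1 lt2.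
    by have := ltn_trans lt1 lt2; rewrite ltnn.
  by have := ltn_trans lt1 lt2; rewrite ltnn.
have nz_ea : edge_mx e a != 0.
  have ne_ab : (a == b) = false.
    by apply/negP=> /eqP eq_ab; rewrite eq_ab F_irr in Fab.
  rewrite edge_mxE taylorE.
  case/orP: eab => /eqP ->; rewrite [_.1]/= [_.2]/= eqxx ne_ab.
    by rewrite mulr1n mulr0n subr0 -msupp_eq0 msuppX.
  by rewrite mulr1n mulr0n sub0r oppr_eq0 -msupp_eq0 msuppX.
move/rowP/(_ a): z_rel; rewrite mxE [RHS]mxE (bigD1 e) //= big1 => [|e' ne_e'].
  by move/eqP; rewrite addr0 mulf_eq0 (negbTE ze) (negbTE nz_ea).
apply/eqP; rewrite mulf_eq0; apply/orP.
case: (altP (z 0 e' =P 0)) => [_ | ze']; [by left | right].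
by apply: contraNT ne_e' => nz; rewrite (only_e e').
Qed.

(** Let [C] be the component of [a] among the generators dividing [L]. On an
    edge relation times a polynomial, the sum over [i] in [C] of the coefficient
    of [L] in [w_i u_i] vanishes: both ends of the edge see the same coefficient,
    and it is zero unless both divide [L]. On the relation of [a] and [b] that
    sum is 1 if [b] is outside [C]. *)
Lemma edge_span_connect a b (L := mlcm (tnth u a) (tnth u b)) :
  edge_span (taylor a b) ->
  connect (fun i j => [&& E i j, (tnth u i <= L)%MM & (tnth u j <= L)%MM]) a b.
Proof.
case=> z def_ab; set eL := (fun i j : 'I_m => _).
have eL_sym : connect_sym eL.
  apply: sym_connect_sym => i j; rewrite /eL E_sym.
  by congr (_ && _); apply: andbC.
pose C i := connect eL a i; pose gC : 'cV[S]_m := \col_o ('X_[tnth u o] *+ C o).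
have: ((taylor a b *m gC) 0 0)@_L = 0.
  rewrite def_ab -mulmxA mxE raddf_sum big1 //= => e _.
  have -> : (edge_mx *m gC) e 0 = (row e edge_mx *m gC) 0 0.
    by rewrite -row_mul [RHS]mxE.
  rewrite rowK taylor_mul_col; set i := _.1; set j := _.2.
  have Eij : E i j by have := enum_valP e; rewrite inE => /andP[].
  rewrite mulrBr !mulrnAr mcoeffB !mcoeffMn mcoeff_mulX lem_mlcm.
  case: ifP => [/andP[iL jL] | _]; last by rewrite !mul0rn subrr.
  have eL_ij : eL i j by rewrite /eL Eij iL jL.
  have -> : C i = C j by rewrite /C; apply: (same_connect_r eL_sym); apply: connect1.
  exact: subrr.
rewrite taylor_mul_col -/L {1}/C connect0 mcoeffB mcoeffMn mcoeffX eqxx.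
rewrite mcoeffMn mcoeffX eqxx -/(C b); case: (C b) => // /eqP.
by rewrite mulr0n subr0 oner_eq0.
Qed.

End EdgeRelations.

(** * Syzygies of the generators *)

Section LinearSyzygies.
Variables (k : fieldType) (n d m : nat) (J : {mpoly k[n]} -> Prop).
Variables (u : m.-tuple 'X_{1..n}) (E : rel 'I_m).
Local Notation S := {mpoly k[n]}.
Local Notation gens := (gens k u).

(** In the lowest degree in which [g * f] can live, only the constant term of
    [g] matters. *)
Lemma mcoeff_mul_homog (g f : S) t :
  f \is (mdeg t).-homog -> (g * f)@_t = g@_0%MM * f@_t.
Proof.
move=> hom_f; rewrite [in LHS](mpolyE f) mulr_sumr raddf_sum /=.
have term r : r \in msupp f ->
    (g * (f@_r *: 'X_[r]))@_t = if r == t then g@_0%MM * f@_t else 0.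
  move=> r_f; rewrite -scalerAr mcoeffZ mcoeff_mulX.
  have [-> | ne_rt] := eqVneq r t.
    have -> : (t - t)%MM = 0%MM by apply/mnmP=> i; rewrite mnmBE mnm0E subnn.
    by rewrite lepm_refl mulrC.
  case: ifP => [le_rt | _]; last by rewrite mulr0.
  by case/eqP: ne_rt; apply: lem_mdeg_eq le_rt _; rewrite (dhomog_mf hom_f r_f).
rewrite (eq_big_seq _ term).
have [t_f | t_f] := boolP (t \in msupp f).
  rewrite (bigD1_seq t) ?msupp_uniq //= eqxx big1 ?addr0 // => r.
  by move/negbTE ->.
rewrite (memN_msupp_eq0 t_f) mulr0 big_seq big1 // => r r_f.
by case: eqP => // eq_rt; rewrite eq_rt (negbTE t_f) in r_f.
Qed.

Hypothesis J_mono : forall f, J f <-> monomial_ideal (min_gen J) f.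
Hypothesis J_deg : generated_in_degree J d.
Hypothesis u_enum : enumerates_min_gens J u.

Lemma tnth_min_gen i : min_gen J (tnth u i).
Proof. by apply/u_enum.2/mem_tnth. Qed.

Lemma tnth_mdeg i : mdeg (tnth u i) = d.
Proof. exact/J_deg/tnth_min_gen. Qed.

Lemma ideal_gensP f : J f <-> exists w : 'rV[S]_m, f = (w *m gens) 0 0.
Proof.
rewrite J_mono; split=> [[s sP ->] | [w ->]]; last first.
  rewrite -phiE; exists [seq (w 0 i, 'X_[tnth u i]) | i <- enum 'I_m].
    by move=> _ /mapP[i _ ->]; exists (tnth u i) => //; apply: tnth_min_gen.
  by rewrite big_map /phi big_enum.
elim: s sP => [|c s IHs] sP; first by exists 0; rewrite big_nil mul0mx mxE.
have [|w def_w] := IHs; first by move=> e e_s; apply: sP; rewrite inE e_s orbT.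
have [_ /u_enum.2/tnthP[i ->] def_c] := sP c (mem_head _ _).
exists (c.1 *: delta_mx 0 i + w); rewrite big_cons def_w def_c.
by rewrite mulmxDl -scalemxAl -rowE !mxE.
Qed.

Lemma homog_part_gens (f : S) : J f -> f \is d.-homog ->
  f = \sum_(i < m) (f@_(tnth u i))%:MP * 'X_[tnth u i].
Proof.
move=> Jf hom_f; apply/mpolyP=> t; rewrite raddf_sum /=.
have coef i : ((f@_(tnth u i))%:MP * 'X_[tnth u i])@_t =
    if tnth u i == t then f@_t else 0.
  rewrite mul_mpolyC mcoeffZ mcoeffX.
  by case: eqP => [-> | _]; rewrite ?mulr1 ?mulr0.
rewrite (eq_bigr _ (fun i _ => coef i)).
have [/tnthP[i def_t] | t_u] := boolP (t \in (u : seq _)).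
  rewrite (bigD1 i) //= -def_t eqxx big1 ?addr0 // => j ne_ji.
  case: eqP => // eq_jt; case/eqP: ne_ji; apply: (tnth_uniq_inj u_enum.1).
  by rewrite eq_jt.
rewrite big1 => [|i _]; last first.
  by case: eqP => // def_t; rewrite -def_t mem_tnth in t_u.
apply: memN_msupp_eq0; apply: contra t_u => t_f.
have [v min_v le_vt] := (monomial_idealP _ _).1 ((J_mono f).1 Jf) t t_f.
have <- : v = t; last exact/u_enum.2.
by apply: lem_mdeg_eq le_vt _; rewrite (J_deg min_v) (dhomog_mf hom_f t_f).
Qed.

Hypothesis E_span : forall w, linear_syzygy u w -> edge_span (k := k) u E w.

(** The degree [d] part of [J] has the monomials [u_i] as a basis, and the
    generators given by the resolution span it too. Hence these two families
    are exchanged by scalar matrices, which turn the linear relations given by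
    the first differential into linear relations between the [u_i]. *)
Lemma linear_resolution_kernel (w : 'rV[S]_m) :
  linear_resolution J d -> w *m gens = 0 ->
  edge_span u E w.
Proof.
case=> R lin w0; pose f := augm R; pose D := diff R 0.
have f_hom j : f j 0 \is d.-homog.
  by have := augm_homog j; rewrite /homog_entry lin subn0 addn0.
have Jf j : J (f j 0).
  by apply/(augm_onto R); exists (delta_mx 0 j); rewrite -rowE mxE.
pose A : 'M[S]_(_, m) := \matrix_(j, i) ((f j 0)@_(tnth u i))%:MP.
have def_f : f = A *m gens.
  apply/colP=> j; rewrite (homog_part_gens (Jf j) (f_hom j)) mxE.
  by apply: eq_bigr => i _; rewrite !mxE.
have u_span i : exists c : 'rV_(rank R 0), 'X_[tnth u i] = (c *m f) 0 0.
  by apply/(augm_onto R); have [] := tnth_min_gen i.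
have [c def_u] := fin_all_exists u_span.
pose B : 'M[S]_(m, _) := \matrix_(i, j) ((c i 0 j)@_0%MM)%:MP.
have BA : B *m A = 1%:M.
  apply/matrixP=> i i'; rewrite !mxE.
  have -> : (i == i')%:R = (('X_[tnth u i] : S)@_(tnth u i'))%:MP :> S.
    rewrite mcoeffX (inj_eq (tnth_uniq_inj u_enum.1)).
    by case: (i == i'); rewrite ?mpolyC1 ?mpolyC0.
  rewrite def_u mxE raddf_sum raddf_sum /=; apply: eq_bigr => j _.
  rewrite !mxE -mpolyCM mcoeff_mul_homog //.
  by rewrite tnth_mdeg.
have Df : D *m f = 0.
  apply/row_matrixP=> e; rewrite row_mul row0.
  by apply: (exact0 (m:=R) (row e D)).2; exists (delta_mx 0 e); rewrite -rowE.
have [z def_wB] : exists z, w *m B = z *m D.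
  apply: (exact0 (m:=R) (w *m B)).1; rewrite -/f.
  by rewrite def_f mulmxA -(mulmxA w) BA mulmx1.
have -> : w = z *m (D *m A) by rewrite mulmxA -def_wB -mulmxA BA mulmx1.
apply: edge_span_mulmx => e; apply: E_span; split=> [i|]; last first.
  by apply/phi_eq0; rewrite -row_mul -mulmxA -def_f Df row0.
rewrite !mxE; apply: rpred_sum => j _; rewrite !mxE mulrC mul_mpolyC.
apply: rpredZ; have := @diff_homog _ _ _ R 0 e j.
by rewrite /homog_entry !lin leq_add2l subnDl.
Qed.

Lemma exchange_syzygy (i j : 'I_m) (x y : 'I_n) :
  (U_(x) + tnth u i)%MM = (U_(y) + tnth u j)%MM ->
  linear_syzygy u ('X_x *: delta_mx 0 i - 'X_y *: delta_mx 0 j : 'rV[S]_m).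
Proof.
move=> eq_ij; split=> [o|].
  rewrite !mxE !mulr_natr.
  by apply: rpredB; apply: rpredMn; rewrite dhomogX /= mdeg1.
apply/phi_eq0/rowP=> o; rewrite ord1 mulmxBl -!scalemxAl -!rowE !mxE.
by rewrite -!mpolyXD eq_ij subrr.
Qed.

(** If [v_i] carries the last nonzero coefficient of a relation, that coefficient
    is a combination of variables [x_l] with [x_l v_i = x_b v_j] for some
    [j < i], so it can be removed at the cost of linear relations. *)
Lemma quotients_kernel s (w : 'rV[S]_m) :
  enumerates_min_gens J s -> quotient_order s -> w *m gens = 0 ->
  edge_span u E w.
Proof.
move=> [s_uniq s_enum] s_quo w0.
have u_s i : tnth u i \in s by apply/s_enum/tnth_min_gen.
suff main i : (i <= size s)%N -> forall w : 'rV[S]_m, w *m gens = 0 ->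
    (forall j, (i <= index (tnth u j) s)%N -> w 0 j = 0) -> edge_span u E w.
  by apply: (main (size s)) => // j; rewrite leqNgt index_mem u_s.
elim: i => [|i IHi] lt_is {}w {}w0 w_supp.
  have -> : w = 0 by apply/rowP=> j; rewrite mxE w_supp.
  exact: edge_span0.
pose v := nth 0%MM s i.
have v_s : v \in s by apply: mem_nth.
have [j def_v] : exists j, tnth u j = v.
  by have /s_enum/u_enum.2/tnthP[j ->] := v_s; exists j.
have idx_j : index (tnth u j) s = i by rewrite def_v index_uniq.
have [B s_quoB] := s_quo i lt_is.
(* The relations usable to cancel the coefficient of v. *)
pose low (g : 'rV[S]_m) := [/\ edge_span u E g, g *m gens = 0 &
  forall o, (i < index (tnth u o) s)%N -> g 0 o = 0].
have lead t : t \in msupp (w 0 j) -> exists2 g, low g & g 0 j = 'X_[t].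
  rewrite mcoeff_msupp => w_t.
  have [l lB le_lt] : exists2 l, l \in B & (U_(l) <= t)%MM.
    apply/s_quoB.
    (* In the relation w, the monomial v + t of the j-th term must be cancelled
       by another term, whose generator comes earlier in s. *)
    have [o ne_oj nz_o] : exists2 o, o != j &
        (w 0 o * 'X_[tnth u o])@_(v + t) != 0.
      apply/exists_inP; apply: contraNT w_t => /exists_inPn all0.
      have /phi_eq0/(congr1 (mcoeff (v + t)%MM)) := w0.
      rewrite /phi (bigD1 j) //= def_v raddfD raddf_sum /= mcoeffMX mcoeff0.
      rewrite big1 => [|o /all0]; last by rewrite negbK => /eqP.
      by rewrite addr0 => ->.
    exists (tnth u o).
      rewrite in_take // ltn_neqAle -{1}idx_j -ltnS ltnNge.
      apply/andP; split.
        apply: contra ne_oj => /eqP eq_idx; apply/eqP/(tnth_uniq_inj u_enum.1).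
        by rewrite -(nth_index 0%MM (u_s o)) eq_idx nth_index.
      by apply: contra nz_o => /w_supp ->; rewrite mul0r mcoeff0.
    by move: nz_o; rewrite mcoeff_mulX addmC; case: ifP; rewrite ?eqxx.
  have [v' v's le_v'] : exists2 v', v' \in take i s & (v' <= U_(l) + v)%MM.
    by apply/s_quoB; exists l; rewrite ?lepm_refl.
  have /s_enum/u_enum.2/tnthP[o def_v'] := mem_take v's.
  (* Degrees force an exchange of one variable: x_l v = x_b v'. *)
  have /mdeg1P[b /eqP def_b] : mdeg (U_(l) + v - tnth u o)%MM == 1%N.
    rewrite def_v' in le_v'; rewrite -(eqn_add2r d) -{1}(tnth_mdeg o) -mdegD.
    by rewrite submK // mdegD mdeg1 -def_v tnth_mdeg.
  have eq_jo : (U_(l) + tnth u j)%MM = (U_(b) + tnth u o)%MM.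
    by rewrite def_v -def_b submK // -def_v'.
  have idx_o : (index (tnth u o) s < i)%N by rewrite -def_v'; apply: index_ltn.
  exists ('X_[t - U_(l)] *: ('X_l *: delta_mx 0 j - 'X_b *: delta_mx 0 o)).
    have lin := exchange_syzygy eq_jo; split.
    - exact/edge_spanZ/E_span.
    - by case: lin => _ /phi_eq0 lin0; rewrite -scalemxAl lin0 scaler0.
    move=> p lt_ip; rewrite !mxE.
    case: (p =P j) => [eq_pj | _]; first by rewrite eq_pj idx_j ltnn in lt_ip.
    case: (p =P o) => [eq_po | _]; last by rewrite !mulr0 subrr mulr0.
    by rewrite eq_po ltnNge ltnW in lt_ip.
  have ne_jo : (j == o) = false.
    by apply/eqP=> eq_jo'; rewrite -eq_jo' idx_j ltnn in idx_o.
  by rewrite !mxE !eqxx ne_jo mulr1 mulr0 subr0 -mpolyXD submK.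
(* Cancel one monomial of the leading coefficient after the other. *)
have [g [g_span g0 g_supp] def_g] : exists2 g, low g & g 0 j = w 0 j.
  rewrite (mpolyE (w 0 j)).
  have: {subset msupp (w 0 j) <= msupp (w 0 j)} by [].
  elim: {1 3}(msupp (w 0 j)) => [_ | t r IHr sub_r].
    exists 0; last by rewrite big_nil mxE.
    by split=> [||o _]; [apply: edge_span0 | apply: mul0mx | rewrite mxE].
  have [|h [h_span h0 h_supp] def_h] := IHr.
    by move=> q q_r; apply: sub_r; rewrite inE q_r orbT.
  have [|q [q_span q0 q_supp] def_q] := lead t; first exact/sub_r/mem_head.
  pose c : S := ((w 0 j)@_t)%:MP.
  exists (c *: q + h); last by rewrite !mxE big_cons def_h def_q mul_mpolyC.
  split; first exact/edge_spanD/h_span/edge_spanZ.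
    by rewrite mulmxDl -scalemxAl q0 h0 scaler0 addr0.
  by move=> o lt_io; rewrite !mxE q_supp ?h_supp // mulr0 addr0.
rewrite -(subrK g w); apply: edge_spanD g_span; apply: IHi => [||o le_io].
- exact: ltnW.
- by rewrite mulmxBl w0 g0 subrr.
rewrite !mxE; have [eq_oj | ne_oj] := eqVneq o j; first by rewrite eq_oj def_g subrr.
have lt_io : (i < index (tnth u o) s)%N.
  rewrite ltn_neqAle le_io andbT -idx_j; apply: contra ne_oj => /eqP eq_idx.
  apply/eqP/(tnth_uniq_inj u_enum.1).
  by rewrite -(nth_index 0%MM (u_s o)) -eq_idx nth_index.
by rewrite w_supp ?g_supp // subrr.
Qed.

End LinearSyzygies.

(** * Decompositions from trees *)

Lemma connect_homo (T T' : finType) (e : rel T) (e' : rel T') (r : T -> T') :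
    (forall i j, e i j -> connect e' (r i) (r j)) ->
  forall i j, connect e i j -> connect e' (r i) (r j).
Proof.
move=> e_e' i j /connectP[p pth ->].
elim: p i pth => [|i' p IHp] i /=; first by rewrite connect0.
by case/andP=> /e_e' e_ii' /IHp; apply: connect_trans.
Qed.

(** Squarefreeness is what makes the variable [x] of a linear edge absent from
    the generator on its side. *)
Lemma squarefree_exchange n (v w : 'X_{1..n}) (x y : 'I_n) :
    squarefree w -> x != y -> (U_(x) + v)%MM = (U_(y) + w)%MM ->
  [/\ v x = 0%N, w x = 1%N & (w - mgcd v w)%MM = U_(x)%MM].
Proof.
move=> w_sqfree ne_xy /mnmP eq_vw.
have at_x := eq_vw x; rewrite !mnmDE !mnm1E eqxx eq_sym (negbTE ne_xy) in at_x.
have [vx wx] : v x = 0%N /\ w x = 1%N by have := w_sqfree x; lia.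
split=> //; apply/mnmP=> i; have := eq_vw i.
rewrite !mnmBE !mnmDE !mnm1E mnmE.
case: (x =P i) => [<- _ | _]; first by rewrite vx wx.
by case: (y == i); lia.
Qed.

Section TreeDecomposition.
Variables (k : fieldType) (n m : nat) (u : m.-tuple 'X_{1..n}) (E : rel 'I_m).
Hypothesis u_uniq : uniq u.
Hypothesis u_sqfree : forall i, squarefree (tnth u i).
Hypothesis E_linear : subrel E (linear_edge u).
Hypothesis E_sym : ssrbool.symmetric E.
Hypothesis E_irr : irreflexive E.
Hypothesis E_acyc : forall c, ucycle E c -> (size c <= 2)%N.

(** When [L] is the lcm of two generators, this is the graph in which linear
    syzygies must connect them. *)
Definition lcm_edge (W : {set 'I_m}) (L : 'X_{1..n}) : rel 'I_m :=
  fun i j => [&& E i j, i \in W, j \in W, (tnth u i <= L)%MM & (tnth u j <= L)%MM].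

Definition lcm_connected (W : {set 'I_m}) : Prop := forall a b, a \in W -> b \in W ->
  connect (lcm_edge W (mlcm (tnth u a) (tnth u b))) a b.

(** Paths between vertices other than the leaf [a] survive its removal, because
    collapsing [a] onto its neighbour [b] maps edges to edges or points. *)
Lemma lcm_connected_leaf (W : {set 'I_m}) a b : a \in W ->
    (forall i j, i \in W -> j \in W -> E a i -> E a j -> i = j) ->
    E a b -> b \in W -> lcm_connected W ->
  (forall c, c \in W -> c != a -> (tnth u b <= mlcm (tnth u a) (tnth u c))%MM)
  /\ lcm_connected (W :\ a).
Proof.
move=> aW leaf_a Eab bW W_conn; split=> [c cW ne_ca | c1 c2].
  have /connectP[[|i p] /= pth def_c] := W_conn a c aW cW.
    by rewrite def_c eqxx in ne_ca.
  case/andP: pth => /and5P[Eai _ iW _ le_i] _.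
  by rewrite (leaf_a b i).
rewrite !in_setD1 => /andP[ne_c1 c1W] /andP[ne_c2 c2W].
set L := mlcm _ _; pose r i := if i == a then b else i.
have ne_ba : b != a by apply: contraTneq Eab => ->; rewrite E_irr.
suff: connect (lcm_edge (W :\ a) L) (r c1) (r c2).
  by rewrite /r (negbTE ne_c1) (negbTE ne_c2).
apply: connect_homo (W_conn c1 c2 c1W c2W) => i j /and5P[Eij iW jW le_i le_j].
rewrite /r; case: (eqVneq i a) => [eq_ia | ne_ia].
  have eq_jb : j = b by apply: leaf_a => //; rewrite -eq_ia.
  by rewrite eq_jb (negbTE ne_ba) connect0.
case: (eqVneq j a) => [eq_ja | ne_ja].
  have -> : i = b by apply: leaf_a => //; rewrite -eq_ja E_sym.
  exact: connect0.
by apply: connect1; rewrite /lcm_edge Eij !in_setD1 ne_ia ne_ja iW jW le_i.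
Qed.

(** Let [a] be a leaf, [b] its neighbour and [x] the variable that [u_b] has and
    [u_a] lacks. The path from [a] to any other [c] passes through [b], so [u_b]
    divides [lcm (u_a, u_c)] and [x] divides [u_c]: shedding [x] removes exactly
    the leaf. *)
Lemma tree_decomposable (W : {set 'I_m}) (J : {mpoly k[n]} -> Prop) :
    W != set0 -> (forall v, min_gen J v <-> exists2 i, i \in W & v = tnth u i) ->
  lcm_connected W -> variable_decomposable J.
Proof.
have [N] := ubnP #|W|; elim: N => // N IHN in W J *.
rewrite ltnS => le_WN nzW J_gen W_conn.
have [a aW leaf_a] := acyclic_leaf E_sym E_irr E_acyc nzW.
have [eq_Wa | ne_Wa] := eqVneq W [set a].
  apply: VDecOne; exists (tnth u a) => v; rewrite J_gen.
  split=> [[i] | ->]; last by exists a.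
  by rewrite eq_Wa inE => /eqP ->.
have [b [bW Eab]] : exists b, b \in W /\ E a b.
  have /subsetPn[c cW]: ~~ (W \subset [set a]).
    by rewrite subset1 negb_or ne_Wa.
  rewrite inE => ne_ca; have /connectP[[|i p] /= pth def_c] := W_conn a c aW cW.
    by rewrite def_c eqxx in ne_ca.
  by case/andP: pth => /and5P[Eai _ iW _ _] _; exists i.
have [le_b Wa_conn] := lcm_connected_leaf aW leaf_a Eab bW W_conn.
have [x [y eq_ab]] : exists x y : 'I_n,
    (U_(x) + tnth u a)%MM = (U_(y) + tnth u b)%MM.
  by have /E_linear/andP[_ /existsP[x /existsP[y /eqP eq_ab]]] := Eab; exists x, y.
have ne_ba : b != a by apply: contraTneq Eab => ->; rewrite E_irr.
have ne_xy : x != y.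
  apply: contraNneq ne_ba => eq_xy; apply/eqP/esym/(tnth_uniq_inj u_uniq).
  by move: eq_ab; rewrite eq_xy => /addmI.
have [ax bx gcd_ab] := squarefree_exchange (u_sqfree b) ne_xy eq_ab.
have x_div i : i \in W -> (U_(x) <= tnth u i)%MM = (i != a).
  move=> iW; rewrite lep1mP; have [-> | ne_ia] := eqVneq i a; first by rewrite ax.
  by have /mnm_lepP/(_ x) := le_b i iW ne_ia; rewrite mnmE ax bx; case: (tnth u i x).
have nondivP v : min_gen (nondiv_part J x) v <-> v = tnth u a.
  rewrite min_gen_nondiv_part J_gen; split=> [[[i iW ->]] | ->].
    by rewrite x_div // negbK => /eqP ->.
  by rewrite x_div // eqxx; split=> //; exists a.
have divP v : min_gen (div_part J x) v <-> exists2 i, i \in W :\ a & v = tnth u i.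
  rewrite min_gen_div_part J_gen; split=> [[[i iW ->]] | [i]].
    by rewrite x_div // => ne_ia; exists i; rewrite // in_setD1 ne_ia.
  by rewrite in_setD1 => /andP[ne_ia iW] ->; rewrite x_div //; split=> //; exists i.
have b_Wa : b \in W :\ a by rewrite in_setD1 ne_ba.
apply: (@VDecStep _ _ _ x).
- exists 'X_[tnth u a]; first by have /nondivP[] : tnth u a = tnth u a by [].
  by rewrite -msupp_eq0 msuppX.
- move=> v /nondivP ->; exists (tnth u b); first by apply/divP; exists b.
  exact: gcd_ab.
- by apply: VDecOne; exists (tnth u a).
- apply: (IHN (W :\ a)) => //; last by apply/set0Pn; exists b.
  by apply: leq_trans le_WN; rewrite [in X in (_ < X)%N](cardsD1 a) aW.
Qed.

End TreeDecomposition.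

(** * The resolution of a tree *)

Section TreeResolution.
Variables (k : fieldType) (n d m : nat) (J : {mpoly k[n]} -> Prop).
Variables (u : m.-tuple 'X_{1..n}) (E : rel 'I_m).
Local Notation S := {mpoly k[n]}.
Hypothesis J_gens : forall f, J f <-> exists w : 'rV[S]_m, f = (w *m gens k u) 0 0.
Hypothesis u_deg : forall i, mdeg (tnth u i) = d.
Hypothesis u_uniq : uniq u.
Hypothesis E_linear : subrel E (linear_edge u).
Hypothesis E_sym : ssrbool.symmetric E.
Hypothesis E_irr : irreflexive E.
Hypothesis E_acyc : forall c, ucycle E c -> (size c <= 2)%N.
Hypothesis E_span : forall w : 'rV[S]_m, w *m gens k u = 0 -> edge_span u E w.

Definition tree_rank p : nat :=
  match p with 0 => m | 1 => #|edges E| | _ => 0 end.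

Definition tree_diff p : 'M[S]_(tree_rank p.+1, tree_rank p) :=
  match p with 0 => edge_mx k u E | _.+1 => 0 end.

Lemma tree_diff_homog p i j : tree_diff p i j \is 1.-homog.
Proof.
case: p i j => [|p] i j /=; first exact: edge_mx_homog.
by rewrite mxE rpred0.
Qed.

(** The complex [0 -> S(-d-1)^edges -> S(-d)^m -> J -> 0]: exact in the middle
    because the edges span the syzygies, and on the left by [edge_mx_free]. *)
Lemma tree_linear_resolution : linear_resolution J d.
Proof.
pose sh p (i : 'I_(tree_rank p)) := (d + p)%N.
have fin : exists N, forall p, (N < p)%N -> tree_rank p = 0%N.
  by exists 1%N => -[|[]].
have augm_h (j : 'I_m) : homog_entry (sh 0%N j) 0 (gens k u j 0).
  by rewrite /homog_entry /sh subn0 addn0 mxE dhomogX; apply/eqP/u_deg.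
have diff_h p i j : homog_entry (sh p.+1 i) (sh p j) (tree_diff p i j).
  by rewrite /homog_entry /sh leq_add2l leqnSn subnDl subSnn tree_diff_homog.
have ex0 (w : 'rV[S]_m) : w *m gens k u = 0 <-> exists z, w = z *m tree_diff 0.
  split=> [/E_span // | [z ->]].
  by rewrite -mulmxA edge_mx_gens mulmx0.
have exS p (w : 'rV[S]_(tree_rank p.+1)) :
    w *m tree_diff p = 0 <->
    exists z : 'rV_(tree_rank p.+2), w = z *m tree_diff p.+1.
  split=> [w0 | [z ->]]; last by rewrite mulmx0 mul0mx.
  exists 0; rewrite mul0mx; case: p w w0 => [|p] w w0; last exact: thinmx0.
  exact: edge_mx_free w0.
have min_d p i j : (tree_diff p i j)@_0%MM = 0.
  by apply: (dhomog_nemf_coeff (tree_diff_homog i j)); rewrite /= mdeg0.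
by exists (MinGFRes fin augm_h diff_h J_gens ex0 exS min_d).
Qed.

End TreeResolution.

Theorem theorem2p7 (k : fieldType) (n d m : nat)
    (I : {mpoly k[n]} -> Prop)
    (hI : squarefree_monomial_ideal I)
    (hd : generated_in_degree I d)
    (u : m.-tuple 'X_{1..n})
    (hu : enumerates_min_gens I u)
    (G_I : rel 'I_m)
    (hG : first_syzygy_graph k u G_I)
    (hT : is_tree G_I) :
  [<-> linear_resolution I d; variable_decomposable I; linear_quotients I].
Proof.
have [u_uniq u_gen] := hu; have [I_mono I_sqfree] := squarefree_idealP hI.
have [red _ min_rel] := hG; have E_linear := reduction_linear_edge red.
have [m_gt0 E_sym E_irr _ E_acyc] := hT.
have lin_span w : linear_syzygy u w -> edge_span (k := k) u G_I w.
  exact: linear_syzygy_span.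
split; [|split].
- move=> linI.
  apply: (tree_decomposable (W := setT) u_uniq _ E_linear E_sym E_irr E_acyc).
  + by move=> i; apply/I_sqfree/u_gen/mem_tnth.
  + by apply/set0Pn; exists (Ordinal m_gt0).
  + move=> v; rewrite -u_gen; split=> [/tnthP[i ->] | [i _ ->]]; first by exists i.
    exact: mem_tnth.
  move=> a b _ _; set L := mlcm _ _.
  suff: connect (fun i j =>
      [&& G_I i j, (tnth u i <= L)%MM & (tnth u j <= L)%MM]) a b.
    by apply: connect_sub => i j ijL; apply: connect1; rewrite /lcm_edge !inE.
  apply: (edge_span_connect (k := k) E_sym).
  exact: (linear_resolution_kernel I_mono hd hu lin_span linI (taylor_gens _ _ _ _)).
- exact: variable_decomposable_quotients.
case/linear_quotientsP=> s s_enum s_quo.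
apply: (tree_linear_resolution (u := u) (E := G_I)) => //.
- exact: ideal_gensP I_mono hu.
- exact: tnth_mdeg hd hu.
move=> w; exact: (quotients_kernel hd hu lin_span s_enum s_quo).
Qed.
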